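(* Let $(\Omega,\mathcal F)$ be a measurable space, let $\mathcal C\subset\mathcal F$ be a sub-$\sigma$-algebra, and let $\rho:\mathbb F\to\mathbb R$ be a sublinear operator which is continuous from above on $\mathcal F$ and proper (with reference probability measure $P_0$). Then for every $\xi\in\mathbb F$ there exists a unique (up to $P_0$-a.s. equality) $\hat\eta\in\mathbb C$ such that $$\rho\big((\xi-\hat\eta)^2\big)=\inf_{\eta\in\mathbb C}\rho\big((\xi-\eta)^2\big).$$
   Context: $\mathbb F$ denotes the set of all bounded $\mathcal F$-measurable real functions on $\Omega$ and $\mathbb C$ the set of all bounded $\mathcal C$-measurable real functions. A sublinear operator is a functional $\rho:\mathbb F\to\mathbb R$ such that: (i) $\rho(\xi_1)\ge\rho(\xi_2)$ if $\xi_1\ge\xi_2$; (ii) $\rho(c)=c$ for $c\in\mathbb R$; (iii) $\rho(\xi_1+\xi_2)\le\rho(\xi_1)+\rho(\xi_2)$ for all $\xi_1,\xi_2\in\mathbb F$; (iv) $\rho(\lambda\xi)=\lambda\rho(\xi)$ for $\lambda\ge0$. $\rho$ is continuous from above on $\mathcal F$ if for each sequence $(\xi_n)\subset\mathbb F$ with $\xi_n\downarrow0$ (pointwise) one has $\rho(\xi_n)\downarrow0$. $\mathcal P$ denotes the set of all linear functionals on $\mathbb F$ dominated by $\rho$. When $\rho$ is continuous from above, every element of $\mathcal P$ is (expectation $E_P$ under) a probability measure $P$ on $(\Omega,\mathcal F)$, $\rho(\xi)=\sup_{P\in\mathcal P}E_P[\xi]$ for $\xi\in\mathbb F$, and there is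 a probability measure $P_0$ on $(\Omega,\mathcal F)$ such that every $P\in\mathcal P$ is absolutely continuous with respect to $P_0$ and $\{dP/dP_0:P\in\mathcal P\}$ is $\sigma(L^1(P_0),L^\infty(P_0))$-compact; such a $P_0$ is fixed. $\rho$ is called proper if every $P\in\mathcal P$ is equivalent to $P_0$. *)

(* Defs.v *)
From HB Require Import structures.
From mathcomp Require Import all_boot all_order all_algebra.
From mathcomp Require Import all_classical all_reals all_analysis.
Set Implicit Arguments.
Unset Strict Implicit.
Unset Printing Implicit Defensive.
Import Order.TTheory GRing.Theory Num.Theory.
Import numFieldNormedType.Exports.
Local Open Scope classical_set_scope.
Local Open Scope ring_scope.

Definition bounded_measurable (R : realType) (d : measure_display)
    (T : measurableType d) : set (T -> R) :=
  [set xi : T -> R | measurable_fun [set: T] xi /\ bounded_fun xi].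
Arguments bounded_measurable R {d} T.

(* For a sigma-algebra [C], the measurable sets of [g_sigma_algebraType C] are
   exactly the members of [C] (lemma [measurable_g_measurableTypeE]). *)
Definition bounded_submeasurable (R : realType) (d : measure_display)
    (T : measurableType d) (C : set (set T)) : set (T -> R) :=
  bounded_measurable R (g_sigma_algebraType C).
Arguments bounded_submeasurable R {d T} C.

Definition decreases_to (R : realType) (u : R^nat) (l : R) : Prop :=
  nonincreasing_seq u /\ u @ \oo --> l.

Section sublinear_operators.
Variables (R : realType) (d : measure_display) (T : measurableType d).
Local Notation F := (bounded_measurable R T).

(* Functionals on the space [F] of bounded measurable functions are represented
   by total functions on [T -> R]; their values outside [F] are irrelevant. *)
Implicit Types (rho L : (T -> R) -> R) (P : probability T R).

Record sublinear_operator rho : Prop := SublinearOperator {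
  sublinear_monotone : forall xi1 xi2, F xi1 -> F xi2 ->
    (forall x, xi2 x <= xi1 x) -> rho xi2 <= rho xi1;
  sublinear_cst : forall c : R, rho (cst c) = c;
  sublinear_subadditive : forall xi1 xi2, F xi1 -> F xi2 ->
    rho (fun x => xi1 x + xi2 x) <= rho xi1 + rho xi2;
  sublinear_homogeneous : forall (l : R) xi, 0 <= l -> F xi ->
    rho (fun x => l * xi x) = l * rho xi }.

Definition continuous_from_above rho : Prop :=
  forall xi_ : nat -> T -> R, (forall n, F (xi_ n)) ->
    (forall x, decreases_to (fun n => xi_ n x) 0) ->
    decreases_to (fun n => rho (xi_ n)) 0.

Record linear_functional L : Prop := LinearFunctional {
  functional_additive : forall xi1 xi2, F xi1 -> F xi2 ->
    L (fun x => xi1 x + xi2 x) = L xi1 + L xi2;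
  functional_homogeneous : forall (l : R) xi, F xi ->
    L (fun x => l * xi x) = l * L xi }.

Definition dominated_functionals rho : set ((T -> R) -> R) :=
  [set L | linear_functional L /\ forall xi, F xi -> L xi <= rho xi].

(* The dominated functionals, seen as probability measures through
   [L = E_P]. If [rho] is continuous from above, every dominated functional
   is of this form, for a unique [P]. *)
Definition dominated_probabilities rho : set (probability T R) :=
  [set P | exists2 L, dominated_functionals rho L &
     forall xi, F xi -> (L xi)%:E = 'E_P[xi]%E].

End sublinear_operators.

Section weak_topology_L1.
Variables (R : realType) (d : measure_display) (T : measurableType d).
Variable mu : {measure set T -> \bar R}.

Definition L1space := LspaceType mu (lexx (1%E : \bar R)).
Definition Linfspace := LspaceType mu (leey (1%E : \bar R)).

HB.instance Definition _ := gen_eqMixin L1space.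
HB.instance Definition _ := gen_choiceMixin L1space.

Definition L1_pairing (g : Linfspace) (f : L1space) : R :=
  \int[mu]_x (f x * g x).

(* The coarsest topology on L^1 making all the pairings with elements of L^oo
   continuous. *)
Definition weak_L1 : topologicalType :=
  sup_topology (fun g : Linfspace =>
    Topological.class (initial_topology (L1_pairing g))).

End weak_topology_L1.

Section reference_probability.
Variables (R : realType) (d : measure_display) (T : measurableType d).
Implicit Types rho : (T -> R) -> R.

Definition densities rho (P0 : probability T R) : set (L1space P0) :=
  [set f | exists2 P : probability T R, dominated_probabilities rho P &
    (EFin \o f) = Radon_Nikodym (charge_of_finite_measure P) P0 %[ae P0]].
Global Arguments densities rho P0 : clear implicits.

Definition reference_probability rho (P0 : probability T R) : Prop :=
  (forall P : probability T R, dominated_probabilities rho P -> P `<< P0) /\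
  compact (densities rho P0 : set (weak_L1 P0)).

Definition proper_operator rho (P0 : probability T R) : Prop :=
  forall P : probability T R, dominated_probabilities rho P ->
    P `<< P0 /\ P0 `<< P.

End reference_probability.

(* Main.v *)
From HB Require Import structures.
Require Import Defs.
From mathcomp Require Import all_boot all_order all_algebra.
From mathcomp Require Import finmap.
From mathcomp Require Import all_classical all_reals all_analysis.
From mathcomp Require Import measurable_realfun lra.
Set Implicit Arguments.
Unset Strict Implicit.
Unset Printing Implicit Defensive.
Import Order.TTheory GRing.Theory Num.Theory.
Import numFieldNormedType.Exports HBNNSimple.
Local Open Scope classical_set_scope.
Local Open Scope ring_scope.

(** The proof is a direct Hilbert space argument, carried out for the convex
    error eta |-> rho ((xi - eta)^2); no minimax theorem is involved.

    Two facts about rho are used throughout. By Hahn-Banach, every value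
    rho f is attained by some linear L dominated by rho
    ([dominated_functional_attained]). By continuity from above, every such L
    is the expectation under a probability P
    ([expectation_functional_probability]): A |-> L 1_A is sigma-additive, and
    nonnegative bounded measurable functions are increasing limits of simple
    ones. Consequently rho vanishes on the indicator of a P0-null set
    ([sublinear_null_indic]), and rho has a Fatou property along bounded
    sequences that converge off such a set ([sublinear_le_limit]).

    Existence. Let M bound |xi|; clamping eta to [-M, M] does not increase the
    error. So the sets K_n of C-measurable eta with values in [-M, M] and error
    at most 1/(n+1) above the infimum are nonempty, convex and nested. Fix one
    dominated P and let g_n have nearly the least L^2(P) norm in K_n. For
    n <= m the midpoint of g_n and g_m is still in K_n, so its norm cannot be
    much smaller than those of g_n and g_m, and the parallelogram law makes
    (g_n) Cauchy in L^2(P) ([nested_convex_Cauchy]). A subsequence converges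
    P-almost surely ([ae_cvg_subsequence]); as rho is proper, the exceptional
    set is P0-null, and the limit attains the infimum.

    Uniqueness. Let L attain rho at (xi - m)^2, where m is the midpoint of two
    minimizers eta1 and eta2. In the parallelogram law
    L (xi - m)^2 + L (eta1 - eta2)^2 / 4
      = (L (xi - eta1)^2 + L (xi - eta2)^2) / 2
    the first term is at least the infimum and the right-hand side at most the
    infimum, so L (eta1 - eta2)^2 <= 0. Hence eta1 = eta2 almost surely for the
    probability representing L, which is equivalent to P0. *)

(** * A Hahn-Banach theorem on a subspace *)

Section hahn_banach.
Variables (R : realType) (V : lmodType R) (F : set V).
Hypothesis F0 : F 0.
Hypothesis FD : forall x y, F x -> F y -> F (x + y).
Hypothesis FZ : forall (a : R) x, F x -> F (a *: x).

Record sublinear_on (q : V -> R) : Prop := SublinearOn {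
  sublinear_onD : forall x y, F x -> F y -> q (x + y) <= q x + q y;
  sublinear_onZ : forall (l : R) x, 0 <= l -> F x -> q (l *: x) = l * q x }.

Lemma subspaceN x : F x -> F (- x).
Proof. by move=> Fx; rewrite -scaleN1r; exact: FZ. Qed.

Lemma sublinear_on0 q : sublinear_on q -> q 0 = 0.
Proof. by move=> [_ qZ]; rewrite -(scale0r (0 : V)) qZ// mul0r. Qed.

Lemma sublinear_on_geN q : sublinear_on q -> forall x, F x -> - q (- x) <= q x.
Proof.
move=> qs x Fx; have := sublinear_onD qs Fx (subspaceN Fx).
by rewrite subrr sublinear_on0// => h; lra.
Qed.

(** The inequality for l and its instance for l^-1 give the equality. *)
Lemma sublinear_onI q :
  (forall x y, F x -> F y -> q (x + y) <= q x + q y) -> q 0 = 0 ->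
  (forall (l : R) x, 0 < l -> F x -> q (l *: x) <= l * q x) ->
  sublinear_on q.
Proof.
move=> qD q0 qZ; split=> // l x; rewrite le_eqVlt => /predU1P[<- Fx|l0 Fx].
  by rewrite scale0r q0 mul0r.
apply/eqP; rewrite eq_le qZ//=.
have := qZ l^-1 (l *: x); rewrite scalerA mulVf ?gt_eqF// scale1r.
move=> /(_ _ (FZ _ Fx)); rewrite invr_gt0 => /(_ l0).
by rewrite ler_pdivlMl.
Qed.

Section tilt.
Variables (q : V -> R) (y : V).
Hypothesis (qs : sublinear_on q) (Fy : F y).

Let E x : set R := [set q (x + t *: y) - t * q y | t in [set t | 0 <= t]].

(** The modification of q that is linear along y: it lies below q and takes at
    - y a value at most - q y. *)
Definition tilt x := inf (E x).

Let E_lb x : F x -> lbound (E x) (- q (- x)).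
Proof.
move=> Fx _ [t /= t0 <-].
have := sublinear_onD qs (FD Fx (FZ t Fy)) (subspaceN Fx).
rewrite addrAC subrr add0r (sublinear_onZ qs)// => h; lra.
Qed.

Let E_inf x : F x -> has_inf (E x).
Proof.
move=> Fx; split; first by exists (q (x + 0 *: y) - 0 * q y), 0 => /=.
by exists (- q (- x)); exact: E_lb.
Qed.

Lemma tilt_le t x : 0 <= t -> F x -> tilt x <= q (x + t *: y) - t * q y.
Proof. by move=> t0 Fx; apply: ge_inf; [exact: (E_inf Fx).2|exists t]. Qed.

Lemma tilt_le_id x : F x -> tilt x <= q x.
Proof.
by move=> Fx; have := tilt_le (lexx 0) Fx; rewrite scale0r addr0 mul0r subr0.
Qed.

Lemma tilt_sublinear : sublinear_on tilt.
Proof.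
apply: sublinear_onI => [x x' Fx Fx'| |l x l0 Fx].
- rewrite -lerBlDr; apply: lb_le_inf; first exact: (E_inf Fx).1.
  move=> _ [t /= t0 <-]; rewrite lerBlDr -lerBlDl.
  apply: lb_le_inf; first exact: (E_inf Fx').1.
  move=> _ [t' /= t'0 <-].
  have := tilt_le (addr_ge0 t0 t'0) (FD Fx Fx').
  have := sublinear_onD qs (FD Fx (FZ t Fy)) (FD Fx' (FZ t' Fy)).
  by rewrite scalerDl addrACA => h1 h2; lra.
- apply/eqP; rewrite eq_le; apply/andP; split.
    by rewrite (le_trans (tilt_le_id F0))// sublinear_on0.
  apply: lb_le_inf; first exact: (E_inf F0).1.
  by move=> r /(E_lb F0); rewrite oppr0 sublinear_on0// oppr0.
- rewrite -ler_pdivrMl//; apply: lb_le_inf; first exact: (E_inf Fx).1.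
  move=> _ [t /= t0 <-]; rewrite ler_pdivrMl//.
  have := tilt_le (mulr_ge0 (ltW l0) t0) (FZ l Fx).
  rewrite -scalerA -scalerDr (sublinear_onZ qs (ltW l0)); last by auto.
  by rewrite mulrBr mulrA.
Qed.

End tilt.

(** Zorn's lemma applies because the infimum of a chain of sublinear
    functionals is again sublinear; it is finite since each member q of the
    chain satisfies - p (- x) <= q x. *)
Lemma minimal_sublinear p : sublinear_on p ->
  exists q, [/\ sublinear_on q, forall x, F x -> q x <= p x &
    forall q', sublinear_on q' -> (forall x, F x -> q' x <= q x) ->
      forall x, F x -> q x <= q' x].
Proof.
move=> ps.
pose S := {q : V -> R | sublinear_on q /\ forall x, F x -> q x <= p x}.
pose leS (q1 q2 : S) := `[< forall x, F x -> sval q2 x <= sval q1 x >].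
have p_S : sublinear_on p /\ forall x, F x -> p x <= p x by [].
have [| | |q qmin] := @ZL_preorder S (exist _ p p_S) leS.
- by move=> q; apply/asboolP.
- move=> q1 q2 q3 /asboolP h1 /asboolP h2; apply/asboolP => x Fx.
  by rewrite (le_trans (h2 _ Fx))// h1.
- move=> A totA; have [[q0 Aq0]|A0] := pselect (A !=set0); last first.
    by exists (exist _ p p_S) => s As; exfalso; apply: A0; exists s.
  pose E x : set R := [set sval q x | q in A].
  have E0 x : E x !=set0 by exists (sval q0 x), q0.
  have Elb x : F x -> has_lbound (E x).
    move=> Fx; exists (- p (- x)) => _ [q Aq <-].
    have [qs qp] := svalP q.
    rewrite (le_trans _ (sublinear_on_geN qs Fx))// lerN2 qp//.
    exact: subspaceN.
  pose m x := inf (E x).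
  have m_le q x : A q -> F x -> m x <= sval q x.
    by move=> Aq Fx; apply: ge_inf; [exact: Elb|exists q].
  have ms : sublinear_on m.
    apply: sublinear_onI => [x y Fx Fy| |l x l0 Fx].
    + rewrite -lerBlDr; apply: lb_le_inf => // _ [q1 Aq1 <-].
      rewrite lerBlDr -lerBlDl; apply: lb_le_inf => // _ [q2 Aq2 <-].
      rewrite lerBlDl; have [/asboolP h|/asboolP h] := totA _ _ Aq1 Aq2.
      * rewrite (le_trans (m_le _ _ Aq2 (FD Fx Fy)))//.
        rewrite (le_trans (sublinear_onD (svalP q2).1 Fx Fy))//.
        by rewrite lerD2r h.
      * rewrite (le_trans (m_le _ _ Aq1 (FD Fx Fy)))//.
        rewrite (le_trans (sublinear_onD (svalP q1).1 Fx Fy))//.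
        by rewrite lerD2l h.
    + suff -> : m 0 = inf [set 0] by rewrite inf1.
      congr inf; apply/seteqP; split => [_ [q Aq <-]|_ ->] /=.
        by rewrite (sublinear_on0 (svalP q).1).
      by exists q0 => //; rewrite (sublinear_on0 (svalP q0).1).
    + rewrite -ler_pdivrMl//; apply: lb_le_inf => // _ [q Aq <-].
      rewrite ler_pdivrMl// -(sublinear_onZ (svalP q).1 (ltW l0))//.
      by apply: m_le => //; exact: FZ.
  have m_S : sublinear_on m /\ forall x, F x -> m x <= p x.
    split=> // x Fx; rewrite (le_trans (m_le _ _ Aq0 Fx))//.
    exact: (svalP q0).2.
  exists (exist _ m m_S) => q Aq; apply/asboolP => x Fx /=; exact: m_le.
exists (sval q); have [qs qp] := svalP q; split=> // q' q's q'q.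
have q'_S : sublinear_on q' /\ forall x, F x -> q' x <= p x.
  by split=> // x Fx; rewrite (le_trans (q'q _ Fx))// qp.
exact/asboolP/(qmin (exist _ q' q'_S))/asboolP.
Qed.

(** A minimal sublinear L equals its tilt along every y, and
    tilt L y x <= L (x + y) - L y, so L is additive. Minimizing below the tilt
    of p along x0, instead of below p, forces L (- x0) <= - p x0. *)
Theorem hahn_banach_attained p x0 : sublinear_on p -> F x0 ->
  exists L : V -> R,
    [/\ forall x y, F x -> F y -> L (x + y) = L x + L y,
        forall (a : R) x, F x -> L (a *: x) = a * L x,
        forall x, F x -> L x <= p x & L x0 = p x0].
Proof.
move=> ps Fx0.
have [L [Ls Lp Lmin]] := minimal_sublinear (tilt_sublinear ps Fx0).
have LD x y : F x -> F y -> L (x + y) = L x + L y.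
  move=> Fx Fy; apply/eqP; rewrite eq_le (sublinear_onD Ls)//=.
  have := Lmin _ (tilt_sublinear Ls Fy) (tilt_le_id Ls Fy) _ Fx.
  move=> /le_trans/(_ (tilt_le Ls Fy ler01 Fx)).
  by rewrite scale1r mul1r lerBrDr.
have LN x : F x -> L (- x) = - L x.
  move=> Fx; have := LD _ _ Fx (subspaceN Fx).
  by rewrite subrr (sublinear_on0 Ls) => h; lra.
exists L; split=> //.
- move=> a x Fx; have [a0|a0] := leP 0 a; first exact: (sublinear_onZ Ls).
  rewrite -[a]opprK scaleNr LN; last exact: FZ.
  by rewrite (sublinear_onZ Ls) ?mulNr// oppr_ge0 ltW.
- by move=> x Fx; rewrite (le_trans (Lp _ Fx))// tilt_le_id.
- apply/eqP; rewrite eq_le; apply/andP; split.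
    by rewrite (le_trans (Lp _ Fx0))// tilt_le_id.
  have := Lp _ (subspaceN Fx0); rewrite LN// => /le_trans.
  move=> /(_ _ (tilt_le ps Fx0 ler01 (subspaceN Fx0))).
  by rewrite scale1r addNr mul1r (sublinear_on0 ps) => h; lra.
Qed.

End hahn_banach.

(** * Bounded measurable functions *)

Lemma bounded_funP (R : realType) (T : Type) (f : T -> R) :
  bounded_fun (f : T -> R^o) <-> exists M, forall x, `|f x| <= M.
Proof.
split=> [[M [_ Mf]]|[M Mf]].
  by exists (M + 1) => x; apply: Mf => //; rewrite ltrDl.
exists M; split; first exact: num_real.
by move=> N MN x _ /=; rewrite (le_trans (Mf x))// ltW.
Qed.

Section bounded_measurable_algebra.
Context (R : realType) d (T : measurableType d).
Local Notation F := (bounded_measurable R T).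
Implicit Types f g : T -> R.

Lemma bounded_measurableE f :
  F f <-> measurable_fun setT f /\ exists M, forall x, `|f x| <= M.
Proof. by split=> -[mf /bounded_funP bf]. Qed.

Lemma bounded_measurable_cst c : F (fun=> c).
Proof. by apply/bounded_measurableE; split=> //; exists `|c|. Qed.

Lemma bounded_measurableD f g : F f -> F g -> F (fun x => f x + g x).
Proof.
move=> /bounded_measurableE[mf [M Mf]] /bounded_measurableE[mg [N Ng]].
apply/bounded_measurableE; split; first exact: measurable_funD.
by exists (M + N) => x; rewrite (le_trans (ler_normD _ _))// lerD.
Qed.

Lemma bounded_measurableM f g : F f -> F g -> F (fun x => f x * g x).
Proof.
move=> /bounded_measurableE[mf [M Mf]] /bounded_measurableE[mg [N Ng]].
apply/bounded_measurableE; split; first exact: measurable_funM.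
by exists (M * N) => x; rewrite normrM ler_pM.
Qed.

Lemma bounded_measurableZ c f : F f -> F (fun x => c * f x).
Proof. by apply: bounded_measurableM; exact: bounded_measurable_cst. Qed.

Lemma bounded_measurableN f : F f -> F (fun x => - f x).
Proof.
move=> /(bounded_measurableZ (-1)); congr (F _).
by apply/funext => x; rewrite mulN1r.
Qed.

Lemma bounded_measurableB f g : F f -> F g -> F (fun x => f x - g x).
Proof. by move=> Ff /bounded_measurableN; exact: bounded_measurableD. Qed.

Lemma bounded_measurable_sqr f : F f -> F (fun x => f x ^+ 2).
Proof. by move=> Ff; exact: bounded_measurableM. Qed.

Lemma bounded_measurable_norm f : F f -> F (fun x => `|f x|).
Proof.
move=> /bounded_measurableE[mf [M Mf]]; apply/bounded_measurableE; split.
  exact: measurableT_comp.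
by exists M => x; rewrite normr_id.
Qed.

Lemma bounded_measurable_indic (A : set T) : measurable A -> F (\1_A).
Proof.
move=> mA; apply/bounded_measurableE; split; first exact: measurable_indic.
by exists 1 => x; rewrite indicE; case: (_ \in _); rewrite ?normr1 ?normr0.
Qed.

Lemma bounded_measurable_sum (I : Type) (s : seq I) (f : I -> T -> R) :
  (forall i, F (f i)) -> F (fun x => \sum_(i <- s) f i x).
Proof.
move=> Ff; elim: s => [|i s ih].
  by under eq_fun do rewrite big_nil; exact: bounded_measurable_cst.
by under eq_fun do rewrite big_cons; exact: bounded_measurableD.
Qed.

End bounded_measurable_algebra.

(** * Functionals dominated by a sublinear operator *)

Section sublinear_operator_theory.
Context (R : realType) d (T : measurableType d).
Local Notation F := (bounded_measurable R T).
Variable rho : (T -> R) -> R.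
Hypothesis rhos : sublinear_operator rho.

Lemma sublinear_ge0 f : F f -> (forall x, 0 <= f x) -> 0 <= rho f.
Proof.
move=> Ff f0; rewrite -[leLHS](sublinear_cst rhos).
by apply: sublinear_monotone => //; exact: bounded_measurable_cst.
Qed.

Lemma dominated_functional_attained f : F f ->
  exists2 L, dominated_functionals rho L & L f = rho f.
Proof.
move=> Ff.
have [|||||L [LD LZ Lrho Lf]] :=
    @hahn_banach_attained R (T -> R^o) F _ _ _ rho f.
- exact: bounded_measurable_cst.
- exact: bounded_measurableD.
- by move=> a x; exact: bounded_measurableZ.
- by split; [exact: (sublinear_subadditive rhos)|
    move=> l x; exact: (sublinear_homogeneous rhos)].
- by [].
by exists L.
Qed.

End sublinear_operator_theory.

Section dominated_functional_theory.
Context (R : realType) d (T : measurableType d).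
Local Notation F := (bounded_measurable R T).
Variables rho L : (T -> R) -> R.
Hypothesis rhos : sublinear_operator rho.
Hypothesis domL : dominated_functionals rho L.

Lemma dominated_functionalD f g : F f -> F g ->
  L (fun x => f x + g x) = L f + L g.
Proof. exact: (functional_additive domL.1). Qed.

Lemma dominated_functionalZ c f : F f -> L (fun x => c * f x) = c * L f.
Proof. exact: (functional_homogeneous domL.1). Qed.

Lemma dominated_functionalN f : F f -> L (fun x => - f x) = - L f.
Proof.
move=> Ff; rewrite -mulN1r -dominated_functionalZ//.
by congr L; apply/funext => x; rewrite mulN1r.
Qed.

Lemma dominated_functionalB f g : F f -> F g ->
  L (fun x => f x - g x) = L f - L g.
Proof.
move=> Ff Fg; rewrite dominated_functionalD ?dominated_functionalN//.
exact: bounded_measurableN.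
Qed.

Lemma dominated_functional_le f : F f -> L f <= rho f.
Proof. exact: domL.2. Qed.

Lemma dominated_functional_ge0 f : F f -> (forall x, 0 <= f x) -> 0 <= L f.
Proof.
move=> Ff f0; rewrite -oppr_le0 -dominated_functionalN//.
have FNf := bounded_measurableN Ff.
rewrite (le_trans (dominated_functional_le FNf))//.
rewrite -[leRHS](sublinear_cst rhos); apply: sublinear_monotone => //.
  exact: bounded_measurable_cst.
by move=> x; rewrite oppr_le0.
Qed.

Lemma dominated_functional_mono f g : F f -> F g ->
  (forall x, f x <= g x) -> L f <= L g.
Proof.
move=> Ff Fg fg; rewrite -subr_ge0 -dominated_functionalB//.
apply: dominated_functional_ge0; first exact: bounded_measurableB.
by move=> x; rewrite subr_ge0.
Qed.

Lemma dominated_functional_cst c : L (fun=> c) = c.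
Proof.
have Fc r := @bounded_measurable_cst R d T r.
apply/eqP; rewrite eq_le; apply/andP; split.
  by rewrite (le_trans (dominated_functional_le (Fc c)))// (sublinear_cst rhos).
rewrite -lerN2 -dominated_functionalN//.
by rewrite (le_trans (dominated_functional_le (Fc _)))// (sublinear_cst rhos).
Qed.

Lemma dominated_functional_sum (I : Type) (s : seq I) (f : I -> T -> R) :
  (forall i, F (f i)) ->
  L (fun x => \sum_(i <- s) f i x) = \sum_(i <- s) L (f i).
Proof.
move=> Ff; elim: s => [|i s ih].
  under eq_fun do rewrite big_nil.
  by rewrite dominated_functional_cst big_nil.
rewrite big_cons/= -ih -dominated_functionalD//.
  by under eq_fun do rewrite big_cons.
exact: bounded_measurable_sum.
Qed.

Hypothesis rhoc : continuous_from_above rho.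

(** The gap f - f_n decreases to 0, and L is nonnegative and at most rho on
    it. *)
Lemma dominated_functional_cvg (f_ : nat -> T -> R) (f : T -> R) :
  (forall n, F (f_ n)) -> F f ->
  (forall x, nondecreasing_seq (f_ ^~ x)) -> (forall x, f_ ^~ x @ \oo --> f x) ->
  L \o f_ @ \oo --> L f.
Proof.
move=> Ff_ Ff ndf cvgf.
have FB n := bounded_measurableB Ff (Ff_ n).
have [||_ rho0] := rhoc (xi_ := fun n x => f x - f_ n x).
- by move=> n; exact: FB.
- move=> x; split=> [m n mn|]; first by rewrite lerB// ndf.
  rewrite -[X in _ --> X](subrr (f x)); apply: cvgB => //; exact: cvg_cst.
have f_le n x : f_ n x <= f x.
  rewrite -(cvg_lim _ (cvgf x))//; apply: nondecreasing_cvgn_le => //.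
  by apply/cvg_ex; exists (f x).
apply/subr_cvg0; apply: norm_cvg0.
apply: (@squeeze_cvgr _ _ _ _ (cst 0) (fun n => rho (fun x => f x - f_ n x))).
- near=> n; rewrite normr_ge0/= /=.
  rewrite distrC -dominated_functionalB// ger0_norm//.
    exact: dominated_functional_le.
  by apply: dominated_functional_ge0 => // x; rewrite subr_ge0.
- exact: cvg_cst.
- exact: rho0.
Unshelve. all: by end_near. Qed.

(** The measure structure asks for nonnegative values at all sets, while L is
    uncontrolled outside F; hence the value 0 off the sigma-algebra. *)
Definition functional_measure (A : set T) : \bar R :=
  if pselect (measurable A) then (L \1_A)%:E else 0%E.

Lemma functional_measureE A : measurable A -> functional_measure A = (L \1_A)%:E.
Proof. by rewrite /functional_measure; case: pselect. Qed.

Lemma functional_measure0 : functional_measure set0 = 0%E.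
Proof.
rewrite functional_measureE// indic0.
by rewrite (_ : cst 0 = fun=> 0)// dominated_functional_cst.
Qed.

Lemma functional_measure_ge0 A : (0 <= functional_measure A)%E.
Proof.
rewrite /functional_measure; case: pselect => // mA.
rewrite lee_fin; apply: dominated_functional_ge0 => //.
exact: bounded_measurable_indic.
Qed.

Lemma functional_measure_sigma_additive : semi_sigma_additive functional_measure.
Proof.
move=> A mA tA mUA; rewrite functional_measureE//.
have FA n : F \1_(A n) by exact: bounded_measurable_indic.
rewrite (_ : (fun n => _) =
    fun n => (L (fun x => \sum_(k < n) \1_(A k) x))%:E); last first.
  apply/funext => n.
  rewrite (dominated_functional_sum _ (f := fun k : 'I_n => \1_(A k)))//.
  rewrite -sumEFin big_mkord.
  by apply: eq_bigr => k _; rewrite functional_measureE.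
apply: cvg_EFin; first by near=> n.
apply: dominated_functional_cvg.
- move=> n.
  exact: (bounded_measurable_sum _ (f := fun k : 'I_n => \1_(A k))).
- exact: bounded_measurable_indic.
- move=> x; apply/nondecreasing_seqP => n.
  by rewrite big_ord_recr/= lerDl.
move=> x; rewrite indicE; have [|xNA] := boolP (_ \in _); last first.
  rewrite (_ : (fun _ => _) = cst 0); first exact: cvg_cst.
  apply/funext => n; rewrite big1// => k _; rewrite indicE.
  apply/eqP; rewrite pnatr_eq0 eqb0; apply: contra xNA.
  by rewrite !inE => Akx; exists k.
rewrite inE => -[k _ Akx].
apply: cvg_near_cst.
near=> n; have kn : (k < n)%N by near: n; exact: nbhs_infty_gt.
rewrite (bigD1 (Ordinal kn))//= indicE mem_set// big1 ?addr0// => i /eqP ik.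
rewrite indicE memNset// => Aix; apply: ik; apply/val_inj => /=.
by apply: tA => //; exists x.
Unshelve. all: by end_near. Qed.

HB.instance Definition _ := isMeasure.Build _ _ _ functional_measure
  functional_measure0 functional_measure_ge0 functional_measure_sigma_additive.

Lemma functional_measure_setT : functional_measure setT = 1%E.
Proof.
rewrite functional_measureE// indicT.
by rewrite (_ : cst 1 = fun=> 1)// dominated_functional_cst.
Qed.

HB.instance Definition _ :=
  Measure_isProbability.Build _ _ _ functional_measure functional_measure_setT.

Definition functional_probability : probability T R := functional_measure.

Lemma functional_probability_nnsfun (f : {nnsfun T >-> R}) :
  (\int[functional_probability]_x (f x)%:E)%E = (L f)%:E.
Proof.
rewrite integralT_nnsfun sintegralE fsbig_finite//=.
pose g y : T -> R := fun x => y * \1_(f @^-1` [set y]) x.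
have Fg y : F (g y).
  exact/bounded_measurableZ/bounded_measurable_indic/measurable_funPTI.
have fE : (f : T -> R) = (fun x => \sum_(y <- fset_set (range f)) g y x).
  by apply/funext => x; rewrite fimfunE fsbig_finite.
rewrite [X in L X]fE dominated_functional_sum// -sumEFin; apply: eq_bigr => y _.
have mfy : measurable (f @^-1` [set y]) by exact: measurable_funPTI.
rewrite functional_measureE// -EFinM dominated_functionalZ//.
exact: bounded_measurable_indic.
Qed.

(** Both sides are continuous along the simple functions increasing to a
    nonnegative f; adding a constant M reduces to that case. *)
Lemma expectation_functional_probability f : F f ->
  (L f)%:E = ('E_functional_probability[f])%E.
Proof.
move: functional_probability functional_probability_nnsfun => P LP Ff.
have /bounded_measurableE[mf [M Mf]] := Ff.
have Fc r := @bounded_measurable_cst R d T r.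
pose g x := f x + M.
have Fg : F g by exact: bounded_measurableD.
have [mg _] := Fg.
have g0 x : 0 <= g x by have := Mf x; rewrite ler_norml /g => /andP[]; lra.
have mEg : measurable_fun setT (EFin \o g) by exact/measurable_EFinP.
pose h := nnsfun_approx measurableT mEg.
have g0' x : setT x -> (0 <= (EFin \o g) x)%E by move=> _; rewrite lee_fin.
have hg x : (fun n => h n x) @ \oo --> g x.
  by have /fine_cvgP[_] := cvg_nnsfun_approx measurableT mEg g0' (x := x) I.
have ndh x : nondecreasing_seq (fun n => h n x).
  by move=> m n mn; exact/lefP/nd_nnsfun_approx.
have Fh n : F (h n) by split; [by []|exact: simple_bounded].
have Lg : (L g)%:E = (\int[P]_x (g x)%:E)%E.
  have LhE : (fun n => (L (h n))%:E) = (fun n => \int[P]_x (h n x)%:E)%E.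
    by apply/funext => n; rewrite LP.
  have cvgL : (fun n => (L (h n))%:E) @ \oo --> (L g)%:E.
    by apply: cvg_EFin; [exact: nearW|exact: dominated_functional_cvg].
  have : (fun n => \int[P]_x (h n x)%:E)%E @ \oo --> (\int[P]_x (g x)%:E)%E.
    rewrite (_ : \int[P]_x (g x)%:E =
                 \int[P]_x limn (fun n => (h n x)%:E))%E; last first.
      apply: eq_integral => x _; apply/esym/cvg_lim => //.
      exact: cvg_nnsfun_approx.
    apply: cvg_monotone_convergence => //.
    - by move=> n; exact/measurable_EFinP.
    - by move=> n x _; rewrite lee_fin.
    - by move=> x _ m n mn; rewrite lee_fin ndh.
  by rewrite -LhE => /(cvg_unique _ cvgL); apply.
have intf : P.-integrable setT (EFin \o f).
  case: Ff => _ bf; apply: measurable_bounded_integrable => //.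
  by rewrite ltey_eq fin_num_measure.
have : (\int[P]_x (g x)%:E = \int[P]_x (f x)%:E + M%:E)%E.
  under eq_integral do rewrite EFinD.
  rewrite integralD//=; last exact: finite_measure_integrable_cst.
  by rewrite integral_cst// [X in (_ * X)%E](@probability_setT _ _ _ P) mule1.
rewrite -Lg dominated_functionalD// dominated_functional_cst EFinD.
rewrite unlock => eqM.
by rewrite -[RHS](@addeK _ M%:E)// -eqM addeK.
Qed.

Lemma functional_probability_dominated :
  dominated_probabilities rho functional_probability.
Proof. by exists L => // f; exact: expectation_functional_probability. Qed.

End dominated_functional_theory.

(** * Null sets and bounded limits under rho *)

Lemma normr_limn_sup (R : realType) (u : R^nat) (M : R) :
  (forall n, `|u n| <= M) -> `|limn_sup u| <= M.
Proof.
move=> uM; have bu : bounded_fun (u : nat -> R^o) by apply/bounded_funP; exists M.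
have ub : has_ubound (range u) by exact: bounded_fun_has_ubound.
have lb : has_lbound (range u) by exact: bounded_fun_has_lbound.
have c : cvgn (sups u) by apply/cvg_ex; eexists; exact: cvg_sups_inf.
rewrite ler_norml; apply/andP; split.
  apply: limr_ge => //; apply: nearW => n.
  have := uM n; rewrite ler_norml => /andP[uMn _].
  rewrite (le_trans uMn)//; apply: ub_le_sup; first exact: has_ubound_sdrop.
  by exists n => /=.
apply: limr_le => //; apply: nearW => n.
apply: ge_sup; first by exists (u n), n => /=.
by move=> _ [m _ <-]; rewrite (le_trans (ler_norm _)).
Qed.

Section sublinear_convergence.
Context (R : realType) d (T : measurableType d).
Local Notation F := (bounded_measurable R T).
Variable rho : (T -> R) -> R.
Hypothesis rhos : sublinear_operator rho.
Hypothesis rhoc : continuous_from_above rho.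

(** rho 1_N is attained by a dominated functional, that is, it is P N for some
    dominated P. *)
Lemma sublinear_null_indic (P0 : probability T R) (N : set T) :
  (forall P : probability T R, dominated_probabilities rho P -> P `<< P0) ->
  measurable N -> P0 N = 0%E -> rho \1_N = 0.
Proof.
move=> rhoP0 mN P0N.
have FN := @bounded_measurable_indic R d T N mN.
have [L domL <-] := dominated_functional_attained rhos FN.
have domP := functional_probability_dominated rhos domL rhoc.
have /null_content_dominatesP/(_ N mN P0N) := rhoP0 _ domP.
by rewrite /= functional_measureE// => -[].
Qed.

(** Bounded convergence for rho: the functions sup_(m >= n) |f_m| decrease to 0
    and dominate |f_n|. *)
Lemma sublinear_norm_cvg0 (f_ : nat -> T -> R) (M : R) :
  (forall n, measurable_fun setT (f_ n)) -> (forall n x, `|f_ n x| <= M) ->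
  (forall x, f_ ^~ x @ \oo --> 0) ->
  rho (fun x => `|f_ n x|) @[n --> \oo] --> 0.
Proof.
move=> mf fM f0.
pose a x n := `|f_ n x|.
have aM x n : `|a x n| <= M by rewrite normr_id.
have ub x : has_ubound (range (a x)).
  by exists M => _ [n _ <-]; exact: fM.
have a_sups n x : a x n <= sups (a x) n.
  by apply: ub_le_sup; [exact: has_ubound_sdrop|exists n => /=].
have Fsups n : F (fun x => sups (a x) n).
  apply/bounded_measurableE; split.
    apply: measurable_fun_sups => [x _|m]; first exact: ub.
    exact: measurableT_comp.
  exists M => x; rewrite ger0_norm; last first.
    exact: le_trans (normr_ge0 _) (a_sups n x).
  by apply: ge_sup => [|_ [m _ <-]]; [exists (a x n); exists n => /=|exact: fM].
have Fa n : F (fun x => a x n).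
  by apply/bounded_measurable_norm/bounded_measurableE; split=> //; exists M.
have [|_ cvg_rho] := rhoc (xi_ := fun n x => sups (a x) n) Fsups.
  move=> x; split; first exact: nonincreasing_sups.
  apply: cvg_sups; rewrite -(normr0 R); exact: cvg_norm.
apply: (@squeeze_cvgr _ _ _ _ (cst 0) (fun n => rho (fun x => sups (a x) n))).
- apply: nearW => n; rewrite (sublinear_ge0 rhos (Fa n) (fun x => normr_ge0 _))/=.
  by apply: (sublinear_monotone rhos) => [||x];
    [exact: Fsups|exact: Fa|exact: a_sups].
- exact: cvg_cst.
- exact: cvg_rho.
Qed.

(** A Fatou property, from f <= f_n + |f - f_n| 1_(~N) + K 1_N: the second
    term tends to 0 under rho by bounded convergence, and the third one
    contributes nothing. *)
Lemma sublinear_le_limit (f_ : nat -> T -> R) (f : T -> R) (M l : R)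
    (N : set T) (u : R^nat) :
  measurable N -> rho \1_N = 0 ->
  (forall n, measurable_fun setT (f_ n)) -> (forall n x, `|f_ n x| <= M) ->
  F f -> (forall x, ~ N x -> f_ ^~ x @ \oo --> f x) ->
  (forall n, rho (f_ n) <= u n) -> u @ \oo --> l -> rho f <= l.
Proof.
move=> mN rhoN mf_ f_M Ff f_f rhou ul.
have /bounded_measurableE[mf [M' fM']] := Ff.
pose g n x := (f x - f_ n x) * \1_(~` N) x.
have mg n : measurable_fun setT (g n).
  apply: measurable_funM; first exact: measurable_funB.
  by apply: measurable_indic; exact: measurableC.
have fgM n x : `|f x - f_ n x| <= M + M'.
  by rewrite (le_trans (ler_normB _ _))// addrC lerD.
have gM n x : `|g n x| <= M + M'.
  rewrite /g normrM indicE; case: (_ \in _); rewrite ?normr1 ?mulr1//.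
  by rewrite normr0 mulr0 (le_trans _ (fgM n x)).
have g0 x : g ^~ x @ \oo --> 0.
  rewrite /g; have [Nx|Nx] := pselect (N x).
    rewrite indicE memNset; last exact.
    under eq_fun do rewrite mulr0.
    exact: cvg_cst.
  rewrite indicE mem_set//; under eq_fun do rewrite mulr1.
  have := cvgB (cvg_cst (f x)) (f_f _ Nx); rewrite subrr; exact.
have rhog := sublinear_norm_cvg0 mg gM g0.
have Fg n : F (g n) by apply/bounded_measurableE; split=> //; exists (M + M').
have Ff_ n : F (f_ n) by apply/bounded_measurableE; split=> //; exists M.
have FN := @bounded_measurable_indic R d T N mN.
have le_rho n : rho f <= u n + rho (fun x => `|g n x|).
  have MM' : 0 <= `|M| + `|M'| by rewrite addr_ge0.
  have Fgn := bounded_measurable_norm (Fg n).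
  have FMN := bounded_measurableZ (`|M| + `|M'|) FN.
  have h x : f x <= f_ n x + `|g n x| + (`|M| + `|M'|) * \1_N x.
    rewrite /g indicC indicE; case: (_ \in _) => /=.
      rewrite mulr0 normr0 addr0 mulr1 -lerBlDl (le_trans (ler_norm _))//.
      by rewrite (le_trans (fgM n x))// lerD// ler_norm.
    by rewrite mulr1 mulr0 addr0 -lerBlDl ler_norm.
  have := sublinear_monotone rhos _ Ff h => /(_ _)/le_trans; apply.
    by do 2! apply: bounded_measurableD => //.
  rewrite (le_trans (sublinear_subadditive rhos _ FMN))//.
    exact: bounded_measurableD.
  rewrite (sublinear_homogeneous rhos)// rhoN mulr0 addr0.
  by rewrite (le_trans (sublinear_subadditive rhos _ _))// lerD2r.
have := cvgD ul rhog; rewrite addr0 => cvgu.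
by apply: (cvgr_to_ge (cvgu _)); exact: nearW.
Qed.

End sublinear_convergence.

(** * Almost surely convergent subsequences of L^2-Cauchy sequences *)

Lemma cvgn_telescope (R : realType) (u : R^nat) (M : R) :
  (forall n, \sum_(k < n) `|u k.+1 - u k| <= M) -> cvgn u.
Proof.
move=> uM.
have : cvgn (series (telescope u)).
  apply: normed_cvg; apply: nondecreasing_is_cvgn.
    apply/nondecreasing_seqP => n.
    by rewrite /normed_series_of /= seriesSr lerDl.
  exists M => _ [n _ <-].
  by rewrite /normed_series_of /= seriesEnat /= big_mkord.
rewrite telescopeK => /cvg_ex[l ul]; apply/cvg_ex; exists (l + u 0%N).
rewrite (@eq_cvg _ _ _ _ (fun n => (u n - u 0%N) + u 0%N)); last first.
  by move=> n; rewrite subrK.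
by apply: cvgD; [exact: ul|exact: cvg_cst].
Qed.

Section L2_Cauchy.
Context (R : realType) d (T : measurableType d) (P : probability T R).

(** Integrate |f| <= (e + f^2 / e) / 2. *)
Lemma integral_norm_le (f : T -> R) (e : R) : 0 < e -> measurable_fun setT f ->
  (\int[P]_x (f x ^+ 2)%:E <= (e ^+ 2)%:E)%E -> (\int[P]_x `|f x|%:E <= e%:E)%E.
Proof.
move=> e0 mf fe.
have mf2 : measurable_fun setT (fun x => f x ^+ 2) by exact: measurable_funX.
pose c := (2 * e)^-1.
have c0 : 0 <= c by rewrite invr_ge0 mulr_ge0// ltW.
have ce2 : c * e ^+ 2 = e / 2.
  by rewrite /c invfM -mulrA expr2 mulKf ?gt_eqF// mulrC.
apply: (@le_trans _ _ (\int[P]_x ((e / 2)%:E + c%:E * (f x ^+ 2)%:E))%E).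
  apply: ge0_le_integral => //.
  - by apply/measurable_EFinP; exact: measurableT_comp.
  - apply/measurable_EFinP; apply: measurable_funD => //.
    by apply: measurable_funM.
  - move=> x _; rewrite -EFinM -EFinD lee_fin.
    have := sqr_ge0 (e - `|f x|); rewrite sqrrB real_normK ?num_real// => h.
    by rewrite -ce2 -mulrDr ler_pdivlMl ?mulr_gt0//; lra.
rewrite ge0_integralD//; last 3 first.
- by move=> x _; rewrite lee_fin divr_ge0// ltW.
- by move=> x _; rewrite -EFinM lee_fin mulr_ge0 ?sqr_ge0.
- by apply/measurable_EFinP; exact: measurable_funM.
rewrite integral_cst// [X in (_ * X)%E](@probability_setT _ _ _ P) mule1.
rewrite ge0_integralZl_EFin//; last 2 first.
- by move=> x _; rewrite lee_fin sqr_ge0.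
- exact/measurable_EFinP.
apply: (@le_trans _ _ ((e / 2)%:E + c%:E * (e ^+ 2)%:E)%E).
  by rewrite leeD2l// lee_wpmul2l// lee_fin.
by rewrite -EFinM ce2 -EFinD lee_fin; lra.
Qed.

(** Along phi the L^1 norms of the increments are summable, so the sum of the
    absolute increments is integrable, hence finite almost everywhere. *)
Lemma ae_cvg_subsequence (g : nat -> T -> R) (c : R^nat) :
  (forall n, measurable_fun setT (g n)) ->
  (forall n m, (n <= m)%N ->
    (\int[P]_x ((g m x - g n x) ^+ 2)%:E <= (c n)%:E)%E) ->
  c @ \oo --> 0 ->
  exists phi : nat -> nat, (forall k, (k <= phi k)%N) /\
    {ae P, forall x, cvgn (fun k => g (phi k) x)}.
Proof.
move=> mg gc c0.
(* Increments of L^1 norm at most e k sum up to at most 1. *)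
pose e (k : nat) : R := 1 / (2 ^ k.+1)%:R.
have e0 k : 0 < e k by rewrite divr_gt0// ltr0n expn_gt0.
have /choice[N NP] k : exists N, forall n, (N <= n)%N -> c n <= e k ^+ 2.
  have [N _ NP] : \forall n \near \oo, c n <= e k ^+ 2.
    by apply: (cvgr_le 0) => //; rewrite exprn_gt0.
  by exists N => n; exact: NP.
(* The partial sums make phi nondecreasing, so that the bound on the tail
   from phi k applies to g (phi k.+1). *)
pose phi k := (k + \sum_(j < k.+1) N j)%N.
exists phi; split; first by move=> k; rewrite leq_addr.
have phiN k : (N k <= phi k)%N.
  by rewrite /phi big_ord_recr/= addnA leq_addl.
have phiS k : (phi k <= phi k.+1)%N.
  rewrite /phi [in leqRHS]big_ord_recr/= addnA (leq_trans _ (leq_addr _ _))//.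
pose D k x := g (phi k.+1) x - g (phi k) x.
have mD k : measurable_fun setT (D k) by exact: measurable_funB.
have mnD k : measurable_fun setT (fun x => `|D k x|%:E).
  by apply/measurable_EFinP; exact: measurableT_comp.
have D2 k : (\int[P]_x `|D k x|%:E <= (e k)%:E)%E.
  apply: integral_norm_le => //; rewrite (le_trans (gc _ _ (phiS k)))//.
  by rewrite lee_fin NP.
pose S x := (\sum_(0 <= k <oo) `|D k x|%:E)%E.
have S0 x : (0 <= S x)%E by apply: nneseries_ge0 => k _ _; rewrite lee_fin.
have intS : P.-integrable setT S.
  apply/integrableP; split; first exact: ge0_emeasurable_sum.
  apply: (@le_lt_trans _ _ 1%:E); last by rewrite ltry.
  under eq_integral do rewrite gee0_abs//.
  rewrite integral_nneseries//.
  apply: le_trans (epsilon_trick0 xpredT ler01).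
  by apply: lee_nneseries => // k _ _; exact: integral_ge0.
have := integrable_ae measurableT intS.
apply: filterS => x /(_ I) Sx.
apply: (@cvgn_telescope _ _ (fine (S x))) => n.
rewrite -lee_fin fineK// -sumEFin -(big_mkord xpredT (fun k => `|D k x|%:E)).
exact: nneseries_lim_ge.
Qed.

End L2_Cauchy.

(** * Approximate projections onto nested convex sets *)

Definition midpoint (R : realType) (T : Type) (f g : T -> R) : T -> R :=
  fun x => 2^-1 * (f x + g x).

Lemma parallelogram (R : realType) (a b c : R) :
  (a - 2^-1 * (b + c)) ^+ 2 + 4^-1 * (b - c) ^+ 2 =
  2^-1 * ((a - b) ^+ 2 + (a - c) ^+ 2).
Proof. by rewrite !expr2; lra. Qed.

Lemma bounded_measurable_midpoint (R : realType) d (T : measurableType d)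
    (f g : T -> R) : bounded_measurable R T f -> bounded_measurable R T g ->
  bounded_measurable R T (midpoint f g).
Proof. by move=> Ff Fg; apply/bounded_measurableZ/bounded_measurableD. Qed.

Section nested_convex.
Context (R : realType) d (T : measurableType d).
Local Notation F := (bounded_measurable R T).
Variables rho L : (T -> R) -> R.
Hypothesis rhos : sublinear_operator rho.
Hypothesis domL : dominated_functionals rho L.

Lemma dominated_functional_parallelogram (a f g : T -> R) : F a -> F f -> F g ->
  L (fun x => (a x - midpoint f g x) ^+ 2) +
    4^-1 * L (fun x => (f x - g x) ^+ 2) =
  2^-1 * (L (fun x => (a x - f x) ^+ 2) + L (fun x => (a x - g x) ^+ 2)).
Proof.
move=> Fa Ff Fg.
have Fsub u v : F u -> F v -> F (fun x => (u x - v x) ^+ 2).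
  by move=> Fu Fv; exact/bounded_measurable_sqr/bounded_measurableB.
have Fm := bounded_measurable_midpoint Ff Fg.
rewrite -(dominated_functionalZ domL); last exact: Fsub.
rewrite -(dominated_functionalD domL); last exact/bounded_measurableZ/Fsub;
  last exact: Fsub.
rewrite -(dominated_functionalD domL); last exact: Fsub;
  last exact: Fsub.
rewrite -(dominated_functionalZ domL); last first.
  by apply: bounded_measurableD; exact: Fsub.
by congr L; apply/funext => x; rewrite parallelogram.
Qed.

(** Take g n in K n whose squared norm is within 1/(n+1) of the infimum b n
    over K n. The b n increase to a limit beta, and the midpoint of g m and
    g n has squared norm at least b n; the parallelogram law leaves
    2 (beta - b n) + 4 / (n+1) for the squared distance. *)
Lemma nested_convex_Cauchy (K : nat -> set (T -> R)) (M : R) :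
  (forall n, K n !=set0) -> (forall n m, (n <= m)%N -> K m `<=` K n) ->
  (forall n f g, K n f -> K n g -> K n (midpoint f g)) ->
  (forall n f, K n f -> measurable_fun setT f /\ forall x, `|f x| <= M) ->
  exists (g : nat -> T -> R) (c : R^nat), [/\ forall n, K n (g n),
    forall n m, (n <= m)%N -> L (fun x => (g m x - g n x) ^+ 2) <= c n &
    c @ \oo --> 0].
Proof.
move=> K0 Knested Kmid KM.
have KF n f : K n f -> F f.
  by move=> /KM[mf fM]; apply/bounded_measurableE; split=> //; exists M.
pose Q (f : T -> R) := L (fun x => f x ^+ 2).
have Q0 f : F f -> 0 <= Q f.
  move=> Ff; apply: (dominated_functional_ge0 rhos domL) => [|x].
    exact: bounded_measurable_sqr.
  exact: sqr_ge0.
have QM n f : K n f -> Q f <= M ^+ 2.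
  move=> Kf; rewrite -[leRHS](dominated_functional_cst rhos domL).
  apply: (dominated_functional_mono rhos domL) => [| |x].
  - exact/bounded_measurable_sqr/KF/Kf.
  - exact: bounded_measurable_cst.
  - have [_ fM] := KM _ _ Kf.
    by rewrite -real_normK ?num_real// lerXn2r// ?nnegrE// (le_trans _ (fM x)).
have infK n : has_inf (Q @` K n).
  split; first by have [f Kf] := K0 n; exists (Q f), f.
  by exists 0 => _ [f Kf <-]; exact/Q0/KF/Kf.
pose b n := inf (Q @` K n).
have bQ n f : K n f -> b n <= Q f.
  by move=> Kf; apply: ge_inf; [exact: (infK n).2|exists f].
have ndb : nondecreasing_seq b.
  move=> n m nm; apply: lb_le_inf; first exact: (infK m).1.
  by move=> _ [f Kf <-]; apply: bQ; exact: Knested Kf.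
have ubb : has_ubound (range b).
  exists (M ^+ 2) => _ [n _ <-]; have [f Kf] := K0 n.
  exact: le_trans (bQ _ _ Kf) (QM _ _ Kf).
pose beta := sup (range b).
have b_beta : b @ \oo --> beta by exact: nondecreasing_cvgn.
have le_beta n : b n <= beta by apply: ub_le_sup => //; exists n.
have /choice[g gP] n : exists f, K n f /\ Q f <= b n + n.+1%:R^-1.
  have e0 : 0 < n.+1%:R^-1 :> R by rewrite invr_gt0.
  by have [_ [f Kf <-] /ltW Qf] := inf_adherent e0 (infK n); exists f.
exists g, (fun n => 2 * (beta - b n) + 4 * n.+1%:R^-1).
split => [n|n m nm|]; first exact: (gP n).1.
- have [Kn Qn] := gP n; have [Km Qm] := gP m.
  have Qmid := bQ _ _ (Kmid _ _ _ (Knested _ _ nm _ Km) Kn).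
  have := dominated_functional_parallelogram
    (bounded_measurable_cst _ 0) (KF _ _ Km) (KF _ _ Kn).
  have sub0 (f : T -> R) : (fun x => (0 - f x) ^+ 2) = (fun x => f x ^+ 2).
    by apply/funext => x; rewrite sub0r sqrrN.
  rewrite !sub0 -/(Q _) -/(Q (g n)) -/(Q (g m)).
  have mn : m.+1%:R^-1 <= n.+1%:R^-1 :> R by rewrite lef_pV2 ?posrE// ler_nat.
  have := le_beta m.
  move: Qn Qm Qmid mn; rewrite /Q.
  move: n.+1%:R^-1 m.+1%:R^-1 => e e1; lra.
- rewrite [X in _ --> X](_ : 0 = 2 * (beta - beta) + 4 * 0 :> R); last by lra.
  apply: cvgD; apply: cvgM; [exact: cvg_cst| |exact: cvg_cst|exact: cvg_harmonic].
  by apply: cvgB => //; exact: cvg_cst.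
Qed.

End nested_convex.

Lemma bounded_submeasurable_sub (R : realType) d (T : measurableType d)
    (C : set (set T)) : C `<=` measurable ->
  bounded_submeasurable R C `<=` bounded_measurable R T.
Proof.
move=> CT f [mf bf]; split=> // _ Y mY.
have := mf measurableT Y mY; apply: (smallest_sub _ CT).
exact: sigma_algebra_measurable.
Qed.

(** * Least squares minimizers *)

Section least_squares.
Context (R : realType) d (T : measurableType d) (C : set (set T)).
Hypothesis C_sub : C `<=` measurable.
Local Notation F := (bounded_measurable R T).
Local Notation G := (bounded_submeasurable R C).
Variable rho : (T -> R) -> R.
Hypothesis rhos : sublinear_operator rho.
Hypothesis rhoc : continuous_from_above rho.
Variable P0 : probability T R.
Hypothesis rhoP : proper_operator rho P0.
Variable xi : T -> R.
Hypothesis Fxi : F xi.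

Let err (eta : T -> R) := rho (fun x => (xi x - eta x) ^+ 2).

Let GF eta : G eta -> F eta. Proof. exact: bounded_submeasurable_sub. Qed.

Let Ferr eta : G eta -> F (fun x => (xi x - eta x) ^+ 2).
Proof. by move=> /GF Feta; exact/bounded_measurable_sqr/bounded_measurableB. Qed.

Let G_midpoint f g : G f -> G g -> G (midpoint f g).
Proof. exact: (@bounded_measurable_midpoint R _ (g_sigma_algebraType C)). Qed.

Let G0 : G (fun=> 0).
Proof. exact: (@bounded_measurable_cst R _ (g_sigma_algebraType C)). Qed.

Let infimum := inf [set err eta | eta in G].

Lemma has_inf_err : has_inf [set err eta | eta in G].
Proof.
split; first by exists (err (fun=> 0)), (fun=> 0).
exists 0 => _ [eta Geta <-]; apply: (sublinear_ge0 rhos); first exact: Ferr.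
by move=> x; exact: sqr_ge0.
Qed.

Lemma infimum_le eta : G eta -> infimum <= err eta.
Proof. by move=> Geta; apply: ge_inf; [exact: has_inf_err.2|exists eta]. Qed.

Lemma err_midpoint f g : G f -> G g ->
  err (midpoint f g) <= 2^-1 * (err f + err g).
Proof.
move=> Gf Gg; have Fs := bounded_measurableD (Ferr Gf) (Ferr Gg).
have half0 : 0 <= 2^-1 :> R by rewrite invr_ge0.
apply: (@le_trans _ _
    (2^-1 * rho (fun x => (xi x - f x) ^+ 2 + (xi x - g x) ^+ 2))).
  rewrite -(sublinear_homogeneous rhos)//.
  apply: (sublinear_monotone rhos) => [| |x].
  - exact: bounded_measurableZ.
  - exact/Ferr/G_midpoint.
  - by rewrite -parallelogram lerDl mulr_ge0 ?invr_ge0 ?sqr_ge0.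
by rewrite ler_wpM2l// (sublinear_subadditive rhos)//; exact: Ferr.
Qed.

Lemma err_clamp (M : R) eta : (forall x, `|xi x| <= M) -> G eta ->
  exists eta', [/\ G eta', forall x, `|eta' x| <= M & err eta' <= err eta].
Proof.
move=> xiM Geta.
pose eta' x := Num.max (- M) (Num.min M (eta x)).
have eta'M x : `|eta' x| <= M.
  rewrite ler_norml /eta' le_max lexx/= ge_max ge_min lexx/= andbT.
  by have := le_trans (normr_ge0 _) (xiM x); lra.
have Geta' : G eta'.
  apply/bounded_measurableE; split; last by exists M.
  case: Geta => meta _.
  by apply: measurable_maxr => //; exact: measurable_minr.
exists eta'; split=> //; apply: (sublinear_monotone rhos) => [| |x].
- exact: Ferr.
- exact: Ferr.
have := xiM x; rewrite ler_norml /eta' => /andP[h1 h2].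
case: (leP M (eta x)) => h3.
  have -> : Num.max (- M) M = M.
    by apply/max_idPr; have := le_trans (normr_ge0 _) (xiM x); lra.
  by rewrite !expr2; nra.
by case: (leP (- M) (eta x)) => h4 //; rewrite !expr2; nra.
Qed.

(** Properness turns the P-null set where the subsequence diverges into a
    P0-null one. The limit superior gives a candidate that is bounded and
    C-measurable on the whole space, although the null set need not belong to
    C. *)
Lemma exists_minimizer : exists2 eta, G eta & err eta = infimum.
Proof.
have /bounded_measurableE[mxi [M xiM]] := Fxi.
pose K n := [set eta | [/\ G eta, forall x, `|eta x| <= M &
  err eta <= infimum + n.+1%:R^-1]].
have [L domL _] :=
  dominated_functional_attained rhos (bounded_measurable_cst T (0 : R)).
have [||||g [c [Kg gc c0]]] := nested_convex_Cauchy rhos domL (K := K) (M := M).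
- move=> n; have e0 : 0 < n.+1%:R^-1 :> R by rewrite invr_gt0.
  have [_ [eta Geta <-] errlt] := inf_adherent e0 has_inf_err.
  have [eta' [Geta' eta'M le_err]] := err_clamp xiM Geta.
  by exists eta'; split=> //; rewrite (le_trans le_err)// ltW.
- move=> n m nm eta [Geta etaM le_err]; split=> //.
  by rewrite (le_trans le_err)// lerD2l lef_pV2 ?posrE// ler_nat.
- move=> n f h [Gf fM errf] [Gh hM errh]; split.
  + exact: G_midpoint.
  + move=> x; rewrite /midpoint normrM ger0_norm ?invr_ge0//.
    rewrite ler_pdivrMl// (le_trans (ler_normD _ _))//.
    by rewrite mulr_natl mulr2n lerD.
  + rewrite (le_trans (err_midpoint Gf Gh))//.
    by move: n.+1%:R^-1 errf errh => e errf errh; lra.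
- by move=> n f [Gf fM _]; split=> //; case: (GF Gf).
have domP := functional_probability_dominated rhos domL rhoc.
have EP := expectation_functional_probability rhos domL rhoc.
move: (functional_probability rhos domL rhoc) domP EP => P domP EP.
have Gg n : G (g n) by have [] := Kg n.
have gM n x : `|g n x| <= M by have [_ /(_ x)] := Kg n.
have [||//|phi [phi_ge [N [mN PN cvgN]]]] := @ae_cvg_subsequence R _ T P g c.
- by move=> n; case: (GF (Gg n)).
- move=> n m nm; have := gc n m nm; rewrite -lee_fin EP ?unlock//.
  exact/bounded_measurable_sqr/bounded_measurableB/GF/Gg/GF/Gg.
have P0N : P0 N = 0%E.
  by have [_ /null_content_dominatesP] := rhoP domP; apply.
have rhoN : rho \1_N = 0.
  by apply: (sublinear_null_indic rhos rhoc (P0 := P0)) => // P' /rhoP[].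
pose eta x := limn_sup (fun k => g (phi k) x).
have etaM x : `|eta x| <= M by apply: normr_limn_sup.
have Geta : G eta.
  apply/bounded_measurableE; split; last by exists M.
  apply: measurable_fun_limn_sup => [x _|x _|n]; last by case: (Gg (phi n)).
  - by exists M => _ [n _ <-]; rewrite (le_trans (ler_norm _)).
  - exists (- M) => _ [n _ <-].
    by have := gM (phi n) x; rewrite ler_norml => /andP[].
exists eta => //; apply/eqP; rewrite eq_le infimum_le// andbT.
apply: (@sublinear_le_limit R _ T rho rhos rhoc
  (fun k x => (xi x - g (phi k) x) ^+ 2) _ ((M + M) ^+ 2) _ N
  (fun k => infimum + k.+1%:R^-1)) => //.
- by move=> n; case: (Ferr (Gg (phi n))).
- move=> n x; rewrite normrX lerXn2r// ?nnegrE//.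
    by rewrite addr_ge0// (le_trans (normr_ge0 _) (xiM x)).
  by rewrite (le_trans (ler_normB _ _))// lerD.
- exact: Ferr.
- move=> x Nx; have cvg_x : cvgn (fun k => g (phi k) x).
    by apply: contrapT => ncvg; exact/Nx/cvgN.
  rewrite /eta cvg_limn_supE//.
  by apply: cvgM; (apply: cvgB; [exact: cvg_cst|exact: cvg_x]).
- move=> n; have [_ _ le_err] := Kg (phi n); rewrite (le_trans le_err)//.
  by rewrite lerD2l lef_pV2 ?posrE// ler_nat ltnS.
- rewrite -[X in _ --> X]addr0; apply: cvgD; [exact: cvg_cst|exact: cvg_harmonic].
Qed.

(** The functional that attains rho at the squared distance from xi to the
    midpoint sees the strict convexity of the square. *)
Lemma minimizer_ae_unique eta1 eta2 :
  G eta1 -> G eta2 -> err eta1 = infimum -> err eta2 = infimum ->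
  eta1 = eta2 %[ae P0].
Proof.
move=> G1 G2 err1 err2.
have Gm := G_midpoint G1 G2.
have [L domL Lm] := dominated_functional_attained rhos (Ferr Gm).
have F12 := bounded_measurableB (GF G1) (GF G2).
have L12 : L (fun x => (eta1 x - eta2 x) ^+ 2) <= 0.
  have := dominated_functional_parallelogram domL Fxi (GF G1) (GF G2).
  rewrite Lm; have := infimum_le Gm.
  have := dominated_functional_le domL (Ferr G1).
  have := dominated_functional_le domL (Ferr G2).
  by rewrite -!/(err _) err1 err2; lra.
have domP := functional_probability_dominated rhos domL rhoc.
have EP := expectation_functional_probability rhos domL rhoc.
move: (functional_probability rhos domL rhoc) domP EP => P domP EP.
have [_ P0P] := rhoP domP.
apply: (null_dominates_ae_eq measurableT P0P).
have [m12 _] := bounded_measurable_sqr F12.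
have mE : measurable_fun setT (fun x => ((eta1 x - eta2 x) ^+ 2)%:E).
  exact/measurable_EFinP.
have /(ae_eq_integral_abs _ measurableT mE) :
    (\int[P]_x `|((eta1 x - eta2 x) ^+ 2)%:E| = 0)%E.
  under eq_integral do rewrite gee0_abs ?lee_fin ?sqr_ge0//.
  apply/eqP; rewrite eq_le integral_ge0 ?andbT; last first.
    by move=> x _; rewrite lee_fin sqr_ge0.
  have := EP _ (bounded_measurable_sqr F12); rewrite unlock => <-.
  by rewrite lee_fin.
apply: filterS => x /= /(_ I) /eqP; rewrite eqe sqrf_eq0 subr_eq0.
by move=> /eqP.
Qed.

End least_squares.

Theorem theorem3p6 (R : realType) (d : measure_display) (T : measurableType d)
    (C : set (set T)) (C_sigma : sigma_algebra [set: T] C)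
    (C_sub : C `<=` measurable)
    (rho : (T -> R) -> R) (rho_sublinear : sublinear_operator rho)
    (rho_cont : continuous_from_above rho)
    (P0 : probability T R) (P0_ref : reference_probability rho P0)
    (rho_proper : proper_operator rho P0)
    (xi : T -> R) (xi_F : bounded_measurable R T xi) :
  let err (eta : T -> R) := rho (fun x => (xi x - eta x) ^+ 2) in
  let minimizer (eta : T -> R) :=
    bounded_submeasurable R C eta /\
    err eta = inf [set err eta' | eta' in bounded_submeasurable R C] in
  exists eta_hat : T -> R, minimizer eta_hat /\
    forall eta : T -> R, minimizer eta -> eta = eta_hat %[ae P0].
Proof.
move=> err minimizer.
have [eta_hat Ghat errhat] :=
  exists_minimizer C_sub rho_sublinear rho_cont rho_proper xi_F.
exists eta_hat; split=> // eta [Geta erreta].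
exact: (minimizer_ae_unique C_sub rho_sublinear rho_cont rho_proper xi_F).
Qed.
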